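(* Let $\mathbf{a}$ be a weak composition. If $\mathcal{P}(\mathbb{D}(\mathbf{a}))$ is pure and EL-shellable, then the Kohnert polynomial $\mathfrak{K}_{\mathbb{D}(\mathbf{a})}$ is multiplicity free.
   Context: A diagram is a finite set of cells in $\mathbb{Z}_{>0}\times\mathbb{Z}_{>0}$; a cell $(r,c)$ lies in row $r$ (rows numbered from the bottom, starting at $1$) and column $c$. For a weak composition $\mathbf{a}=(a_1,\dots,a_n)$, $\mathbb{D}(\mathbf{a})=\bigcup_{i=1}^n\{(i,j)\mid 1\le j\le a_i\}$. Applying a Kohnert move at row $r$ of a diagram $D$: if row $r$ is nonempty, let $(r,c)$ be its rightmost cell; if there is $r'$ with $1\le r'<r$ and $(r',c)\notin D$, take the largest such $r'$ and replace $(r,c)$ by $(r',c)$; otherwise $D$ is unchanged. $KD(D)$ is the set of diagrams obtainable from $D$ by finite (possibly empty) sequences of Kohnert moves; $\mathcal{P}(D)$ is $KD(D)$ with $D_2\preceq D_1$ iff $D_2$ can be obtained from $D_1$ by Kohnert moves. For a diagram $T$, $wt(T)=\prod_{i\ge1}x_i^{(\text{number of cells in row } i \text{ of } T)}$ and $\mathfrak{K}_D=\sum_{T\in KD(D)}wt(T)$; multiplicity free means every coefficient is $0$ or $1$. A poset is pure if all its maximal chains have the same number of elements. A bounded poset (unique minimum and maximum) is EL-shellable if its covering pairs admit a labeling $\lambda$ by elements of some poset such that every interval $[x,y]$ has a unique saturated chain from $x$ to $y$ with weakly increasing labels, and its label sequence is lexicographically smaller than that of every other saturated chain from $x$ to $y$.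 *)

(* Defs.v *)
From HB Require Import structures.
From mathcomp Require Import all_boot all_order all_algebra.
From mathcomp Require Import finmap mpoly boolp.

Set Implicit Arguments.
Unset Strict Implicit.
Unset Printing Implicit Defensive.

Import Order.TTheory GRing.Theory.

Local Open Scope nat_scope.
Local Open Scope fset_scope.

(* The cell (r, c) lies in row r and column c. Rows and columns are numbered
   from 1; [key_diagram] and [kohnert_move] only produce positive cells from
   positive cells. *)
Notation cell := (nat * nat)%type.
Notation diagram := {fset cell}.

Definition key_diagram (n : nat) (a : n.-tuple nat) : diagram :=
  [fset x in [seq (i, j) | i <- iota 1 n, j <- iota 1 (nth 0 a i.-1)]].

(* An empty \max is 0, so [c] is the column of the rightmost cell of row r
   when row r is nonempty, and [r'] is 0 exactly when no position (i, c) with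
   1 <= i < r is free. *)
Definition kohnert_move (D : diagram) (r : nat) : diagram :=
  let c := \max_(x <- D | x.1 == r) x.2 in
  let r' := \max_(1 <= i < r | (i, c) \notin D) i in
  if has (fun x : cell => x.1 == r) D && (0 < r')
  then (r', c) |` (D `\ (r, c)) else D.

Definition obtainable (D T : diagram) : Prop :=
  exists rs : seq nat, T = foldl kohnert_move D rs.

Definition cells_below (D : diagram) : diagram :=
  [fset x in [seq (r, y.2) | y <- D, r <- iota 0 y.1.+1]].

(* Bounding by [cells_below D] only serves to exhibit KD(D) as a finite set:
   see [KDP]. *)
Definition KD (D : diagram) : {fset diagram} :=
  [fset T : diagram in fpowerset (cells_below D) | `[< obtainable D T >]].

Lemma in_cells_below (D : diagram) (x : cell) :
  reflect (exists2 y, y \in D & (x.1 <= y.1) && (x.2 == y.2))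
          (x \in cells_below D).
Proof.
rewrite !inE; apply: (iffP allpairsPdep).
  case=> y [r [yD]]; rewrite mem_iota /= add0n ltnS => le_r ->.
  by exists y; rewrite //= le_r eqxx.
case=> y yD /andP[le_r /eqP e]; exists y, x.1; rewrite mem_iota add0n ltnS.
by rewrite yD le_r -e -surjective_pairing.
Qed.

Lemma kohnert_moveP (D : diagram) (r : nat) :
  kohnert_move D r = D \/
  exists r' c, [/\ 0 < r' < r, (r, c) \in D, (r', c) \notin D &
    kohnert_move D r = (r', c) |` (D `\ (r, c))].
Proof.
rewrite /kohnert_move; set c := \max_(x <- D | _) _.
set r' := \max_(1 <= i < r | (i, c) \notin D) i.
case: ifP => [|_]; last by left.
case/andP=> hasr r'0; right; exists r', c.
have rcD : (r, c) \in D.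
  have : exists2 x : cell, x \in enum_fset D & (x.1 == r) && (c == x.2).
    have : has (fun x : cell => x.1 == r) (enum_fset D) by [].
    rewrite /c; elim: (enum_fset D) => //= x s IH.
    rewrite big_cons; case: ifP => [xr _|_ /= /IH]; last first.
      by case=> y ys yP; exists y; rewrite // inE ys orbT.
    have [/IH[y ys /andP[yr /eqP ey]]|/hasPn nos] :=
      boolP (has (fun x : cell => x.1 == r) s).
      case: (leqP (\max_(x <- s | x.1 == r) x.2) x.2) => le.
        by exists x; rewrite ?inE ?eqxx //= xr /=.
      exists y; rewrite ?inE ?ys ?orbT // yr /= ey.
      by [].
    exists x; rewrite ?inE ?eqxx //= xr /= big_seq_cond big1 ?maxn0 //.
    by move=> y /andP[/nos /negbTE->].
  by case=> -[i j] xD /andP[/= /eqP <- /eqP ->].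
have {}r'P : (0 < r' < r) && ((r', c) \notin D).
  move: r'0; have: r' = 0 \/ (0 < r' < r) && ((r', c) \notin D).
    rewrite /r' big_seq_cond.
    apply: (big_ind (fun m => m = 0 \/ (0 < m < r) && ((m, c) \notin D))).
    - by left.
    - by move=> x y hx hy; case: (leqP x y).
    - by move=> i /andP[]; rewrite mem_index_iota => ->; right.
  by case=> [->|].
by case/andP: r'P.
Qed.

Lemma obtainable_refl D : obtainable D D. Proof. by exists [::]. Qed.

Lemma obtainable_trans D1 D2 D3 :
  obtainable D1 D2 -> obtainable D2 D3 -> obtainable D1 D3.
Proof.
by move=> [rs ->] [rs' ->]; exists (rs ++ rs'); rewrite foldl_cat.
Qed.

Lemma obtainable_sub D T : obtainable D T -> T `<=` cells_below D.
Proof.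
move=> [rs ->].
have: D `<=` cells_below D.
  by apply/fsubsetP=> x xD; apply/in_cells_below; exists x; rewrite ?leqnn /=.
elim: rs {-2 4}D => //= r rs IH E sE; apply: IH.
case: (kohnert_moveP E r) => [->//|[r' [c [/andP[_ lt] rcE _ ->]]]].
apply/fsubsetP=> x; rewrite in_fset1U in_fsetD1.
case/orP=> [/eqP->|/andP[_ xE]]; last exact: (fsubsetP sE).
have /in_cells_below[y yD /andP[/= le e]] := fsubsetP sE _ rcE.
by apply/in_cells_below; exists y; rewrite //= e andbT (leq_trans (ltnW lt)).
Qed.

Lemma KDP (D T : diagram) : reflect (obtainable D T) (T \in KD D).
Proof.
rewrite !inE /=; apply: (iffP andP) => [[_ /asboolP//]|obt].
by split; [rewrite fpowersetE; exact: obtainable_sub | exact/asboolP].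
Qed.

Definition height (D : diagram) : nat := \sum_(x <- D) x.1.

Lemma height_move D r : kohnert_move D r = D \/ height (kohnert_move D r) < height D.
Proof.
case: (kohnert_moveP D r) => [->|[r' [c [/andP[_ lt] rcD nD ->]]]]; first by left.
right; rewrite /height big_fsetU1 ?in_fsetD1 ?(negbTE nD) ?andbF //=.
by rewrite [ltnRHS](big_fsetD1 (r, c)) //= ltn_add2r.
Qed.

Lemma obtainable_height D T : obtainable D T -> T = D \/ height T < height D.
Proof.
move=> [rs ->]; elim: rs D => [|r rs IH] D /=; first by left.
case: (IH (kohnert_move D r)) => [->|lt]; first exact: height_move.
by right; case: (height_move D r) => [e|]; [rewrite e in lt * | apply: ltn_trans].
Qed.

Fact kohnert_display : Order.disp_t. Proof. exact: (Order.Disp tt tt). Qed.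

Definition kohnert_poset (D : diagram) : Type := KD D.
HB.instance Definition _ D := Finite.copy (kohnert_poset D) (KD D).

Section KohnertOrder.
Variable D : diagram.
Implicit Types S T : kohnert_poset D.

Definition kohnert_le S T : bool := fsval S \in KD (fsval T).

Lemma kohnert_le_refl : reflexive kohnert_le.
Proof. by move=> T; apply/KDP/obtainable_refl. Qed.

Lemma kohnert_le_anti : antisymmetric kohnert_le.
Proof.
move=> S T /andP[/KDP/obtainable_height ST /KDP/obtainable_height TS].
apply: val_inj; case: ST TS => [//|lt] [//|lt'].
by have := ltn_trans lt lt'; rewrite ltnn.
Qed.

Lemma kohnert_le_trans : transitive kohnert_le.
Proof.
by move=> T S U /KDP ST /KDP TU; apply/KDP/(obtainable_trans TU ST).
Qed.

HB.instance Definition _ :=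
  Order.Le_isPOrder.Build kohnert_display (kohnert_poset D)
    kohnert_le_refl kohnert_le_anti kohnert_le_trans.
End KohnertOrder.

Section Posets.
Variables (d : Order.disp_t) (T : finPOrderType d).
Implicit Types (x y z : T) (c : seq T).
Local Open Scope order_scope.

Definition is_chain (C : {set T}) : bool :=
  [forall x in C, forall y in C, x >=< y].

Definition pure : Prop :=
  forall C1 C2 : {set T}, maxset is_chain C1 -> maxset is_chain C2 ->
  #|C1| = #|C2|.

Definition covered_by : rel T :=
  fun x y => (x < y) && [forall z, ~~ ((x < z) && (z < y))].

Definition bounded_poset : Prop :=
  (exists x, forall z, x <= z) /\ (exists y, forall z, z <= y).

(* The saturated chain x = z_0 <. z_1 <. ... <. z_k = y is represented by the
   sequence c = [:: z_1; ...; z_k]. *)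
Definition saturated_chain x y c : bool := path covered_by x c && (last x c == y).

(* Only the values of [lam] on covering pairs matter. *)
Definition label_seq (L : Type) (lam : T -> T -> L) x c : seq L :=
  pairmap lam x c.

Definition EL_labeling (dL : Order.disp_t) (L : porderType dL)
    (lam : T -> T -> L) : Prop :=
  forall x y, x <= y -> exists c,
    [/\ saturated_chain x y c,
        sorted <=%O (label_seq lam x c),
        forall c', saturated_chain x y c' ->
          sorted <=%O (label_seq lam x c') -> c' = c &
        forall c', saturated_chain x y c' -> c' <> c ->
          label_seq lam x c < label_seq lam x c' :> seqlexi L].

Definition EL_shellable : Prop :=
  bounded_poset /\
  exists (dL : Order.disp_t) (L : porderType dL) (lam : T -> T -> L),
    EL_labeling lam.
End Posets.

Arguments pure {d} T.
Arguments bounded_poset {d} T.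
Arguments EL_shellable {d} T.

Definition row_size (T : diagram) (r : nat) : nat :=
  #|` [fset x in T | x.1 == r]|.

Local Open Scope ring_scope.

(* The variable x_r is 'X_i with i = r - 1. The number n of variables is meant
   to bound the rows of the cells of D (hence of every T in KD(D)). *)
Definition wt (n : nat) (T : diagram) : {mpoly int[n]} :=
  \prod_(i < n) 'X_i ^+ row_size T i.+1.

Definition kohnert_poly (n : nat) (D : diagram) : {mpoly int[n]} :=
  \sum_(T <- KD D) wt n T.

Definition multiplicity_free (n : nat) (p : {mpoly int[n]}) : Prop :=
  forall m : 'X_{1..n}, mcoeff m p = 0 \/ mcoeff m p = 1.

(* Main.v *)
Require Import Defs.
From mathcomp Require Import all_boot all_order all_algebra.
From mathcomp Require Import finmap mpoly zify.

(* Write [f i] for the length of row [i] of the key diagram [D]. Sorting the rows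
   by adjacent swaps reaches the minimum of the poset through moves that each
   lower the height (the sum of the row indices of the cells) by one; hence, if
   the poset is pure, every cover lowers the height by one. When there are
   [i < j < k] with [f i < f j], [f i < f k] and [(f i).+1 < maxn (f j) (f k)],
   swaps bring the three rows next to each other, and emptying row [k] down to
   column [(f i).+1] exposes a cover that lowers the height by two. So purity
   excludes such triples.

   Without such triples, a diagram obtainable from [D] is determined by its row
   sizes. Let N_c(s) count its cells of column [c] in rows [>= s]. Then N_c(s) is
   nonincreasing in [c] and bounded by its value on [D], and the row sizes fix
   the sum of N_c(s) over [c]. If two diagrams of equal weight disagree, then for
   some [s] and [c < d] one has N_c(s) < N'_c(s) and N'_d(s) < N_d(s) <= N_c(s);
   so in [D] column [c] has a hole below row [s] and at least two cells above it,
   one of them in a row that reaches column [d]: an excluded triple. *)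

Set Implicit Arguments.
Unset Strict Implicit.
Unset Printing Implicit Defensive.

Import Order.TTheory GRing.Theory.

Local Open Scope fset_scope.
Local Open Scope nat_scope.

Implicit Types (D E T : diagram) (r c s : nat) (f : nat -> nat).

(** * Kohnert moves as slides of one cell *)

Definition legal_move D r r' c : Prop :=
  [/\ 0 < r' < r, (r, c) \in D, (r', c) \notin D,
      forall c', (r, c') \in D -> c' <= c
    & forall q, r' < q < r -> (q, c) \in D].

Definition slide D r r' c : diagram := (r', c) |` (D `\ (r, c)).

Lemma in_slide D r r' c x :
  (x \in slide D r r' c) = (x == (r', c)) || (x != (r, c)) && (x \in D).
Proof. by rewrite in_fset1U in_fsetD1. Qed.

Lemma rightmost_eq D r c : (r, c) \in D ->
  (forall c', (r, c') \in D -> c' <= c) -> \max_(x <- D | x.1 == r) x.2 = c.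
Proof.
move=> rcD cmax; apply/eqP; rewrite eqn_leq; apply/andP; split.
  by apply/bigmax_leqP_seq => -[q e] /= qeD /eqP eq; apply: cmax; rewrite -eq.
by apply: (leq_bigmax_seq (F := snd) (r, c)) => /=.
Qed.

Lemma kohnert_move_legal D r r' c :
  legal_move D r r' c -> kohnert_move D r = slide D r r' c.
Proof.
case=> /andP[r'0 ltr] rcD r'D cmax full; rewrite /kohnert_move.
have -> : has (fun x : cell => x.1 == r) D by apply/hasP; exists (r, c) => /=.
rewrite (rightmost_eq rcD cmax).
suff -> : \max_(1 <= i < r | (i, c) \notin D) i = r' by rewrite r'0.
apply/eqP; rewrite eqn_leq; apply/andP; split; last first.
  apply: (leq_bigmax_seq (F := id) r') => //.
  by rewrite mem_index_iota r'0.
apply/bigmax_leqP_seq => i; rewrite mem_index_iota => /andP[_ ltir] niD.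
by rewrite leqNgt; apply: contra niD => lti; rewrite full // lti.
Qed.

Lemma kohnert_move_cases D r :
  kohnert_move D r = D \/
  exists r' c, legal_move D r r' c /\ kohnert_move D r = slide D r r' c.
Proof.
have [/hasP[[q e] qeD /= /eqP eqr]|nhas] :=
  boolP (has (fun x : cell => x.1 == r) D); last first.
  by left; rewrite /kohnert_move (negbTE nhas).
rewrite {q}eqr in qeD.
have ex_c : exists c, (r, c) \in D by exists e.
have c_le c : (r, c) \in D -> c <= \max_(x <- D | x.1 == r) x.2.
  by move=> rcD; apply: (leq_bigmax_seq (F := snd) (r, c)) => /=.
case: (ex_maxnP ex_c c_le) => c rcD cmax {e qeD ex_c c_le}.
have [/hasP ex_gap|/hasPn full] :=
  boolP (has (fun i => (i, c) \notin D) (index_iota 1 r)).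
  have {}ex_gap : exists i, (0 < i < r) && ((i, c) \notin D).
    by case: ex_gap => i; rewrite mem_index_iota => lti ni; exists i; rewrite lti.
  have gap_le i : (0 < i < r) && ((i, c) \notin D) -> i <= r.
    by case/andP=> /andP[_ /ltnW].
  case: (ex_maxnP ex_gap gap_le) => r' /andP[ltr' nr'] r'max.
  have leg : legal_move D r r' c.
    split=> // q /andP[ltq ltqr]; apply/negPn/negP => nqD.
    have := r'max q; rewrite nqD ltqr (leq_ltn_trans (leq0n r') ltq) => /(_ isT).
    by rewrite leqNgt ltq.
  by right; exists r', c; split=> //; apply: kohnert_move_legal.
left; rewrite /kohnert_move (rightmost_eq rcD cmax) big_seq_cond big_pred0 ?andbF//.
by move=> i; apply/andP => -[/full /negP].
Qed.

Lemma obtainable_move D r : obtainable D (kohnert_move D r).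
Proof. by exists [:: r]. Qed.

Lemma obtainable_ind (P : diagram -> Prop) D :
  P D -> (forall E r r' c, P E -> legal_move E r r' c -> P (slide E r r' c)) ->
  forall T, obtainable D T -> P T.
Proof.
move=> PD step T [rs ->]; elim: rs D PD => //= r rs IH D PD; apply: IH.
by case: (kohnert_move_cases D r) => [->|[r' [c [leg ->]]]] //; apply: step.
Qed.

Lemma obtainable_rows D T n : (forall x, x \in D -> 0 < x.1 <= n) ->
  obtainable D T -> forall x, x \in T -> 0 < x.1 <= n.
Proof.
move=> rowsD; move: T; apply: obtainable_ind => // E r r' c IH [lt rcE _ _ _] x.
rewrite in_slide => /predU1P[->|/andP[_ /IH //]].
by have := IH _ rcE; rewrite /=; lia.
Qed.

Lemma obtainable_first D T : obtainable D T -> T <> D ->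
  exists r r' c, legal_move D r r' c /\ obtainable (slide D r r' c) T.
Proof.
move=> [rs ->]; elim: rs => //= r rs IH neq.
case: (kohnert_move_cases D r) => [e|[r' [c [leg e]]]]; rewrite e in neq *.
  exact: IH.
by exists r, r', c; split=> //; exists rs.
Qed.

Lemma big_slide D r r' c (F : cell -> nat) : (r, c) \in D -> (r', c) \notin D ->
  \sum_(x <- slide D r r' c) F x + F (r, c) = \sum_(x <- D) F x + F (r', c).
Proof.
move=> rcD r'D; rewrite big_fsetU1 ?in_fsetD1 ?(negbTE r'D) ?andbF //=.
by rewrite [in RHS](big_fsetD1 (r, c)) //=; lia.
Qed.

Lemma height_slide D r r' c :
  legal_move D r r' c -> height (slide D r r' c) + r = height D + r'.
Proof. by case=> _ rcD r'D _ _; apply: (big_slide fst). Qed.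

(** * Column counts *)

Definition colcount D c s : nat := \sum_(x <- D) ((x.2 == c) && (s <= x.1)).

Lemma colcount_slide D r r' c d s : legal_move D r r' c ->
  colcount (slide D r r' c) d s =
  colcount D d s - ((d == c) && (r' < s <= r)).
Proof.
case=> /andP[_ ltr] rcD r'D _ _.
have := big_slide (fun x => nat_of_bool ((x.2 == d) && (s <= x.1))) rcD r'D.
rewrite -!/(colcount _ _ _) /= eq_sym; case: (d == c) => /=; last by lia.
by case: (leqP s r) => ?; case: (leqP s r') => ?; lia.
Qed.

Lemma colcountS D c s : colcount D c s = ((s, c) \in D) + colcount D c s.+1.
Proof.
have part (x : cell) : (x.2 == c) && (s <= x.1) =
    (x == (s, c)) + ((x.2 == c) && (s.+1 <= x.1)) :> nat.
  by case: x => q e; rewrite xpair_eqE /=; lia.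
rewrite /colcount (eq_bigr _ (fun x _ => part x)) big_split /=; congr (_ + _).
have [scD|nscD] := boolP ((s, c) \in D).
  rewrite (big_fsetD1 (s, c)) //= eqxx big_seq big1 // => x.
  by rewrite in_fsetD1 => /andP[/negbTE->].
by rewrite big_seq big1 // => x xD; case: eqP => // xe; rewrite -xe xD in nscD.
Qed.

Lemma colcount_gt0 D c s :
  reflect (exists2 q, s <= q & (q, c) \in D) (0 < colcount D c s).
Proof.
apply: (iffP idP) => [|[q lesq qcD]]; last first.
  by rewrite /colcount (big_fsetD1 (q, c)) //= eqxx lesq.
case: (boolP (has (fun x : cell => (x.2 == c) && (s <= x.1)) D)) => [/hasP[[q e]]|].
  by move=> xD /= /andP[/eqP <- leq]; exists q.
move=> /hasPn no; rewrite /colcount big_seq big1 // => x /no.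
by move/negbTE=> ->.
Qed.

Lemma colcount_gt1 D c s q : (q, c) \in D -> 1 < colcount D c s ->
  exists2 q', s <= q' & (q' != q) && ((q', c) \in D).
Proof.
move=> qcD; rewrite /colcount (big_fsetD1 (q, c)) //= => gt1.
have : 0 < colcount (D `\ (q, c)) c s.
  by move: gt1; rewrite -/(colcount (D `\ (q, c)) c s); case: (_ && _); lia.
case/colcount_gt0 => q' lesq'; rewrite in_fsetD1 xpair_eqE eqxx andbT => q'P.
by exists q'.
Qed.

Lemma colcount_inj D E :
  (forall c s, colcount D c s = colcount E c s) -> D = E.
Proof.
move=> eqDE; apply/fsetP => -[s c]; apply/idP/idP;
  have := eqDE c s; rewrite (colcountS D) (colcountS E) eqDE;
  by move=> /addIn; case: (_ \in D); case: (_ \in E).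
Qed.

Lemma colcount_obtainable D T c s : obtainable D T -> colcount T c s <= colcount D c s.
Proof.
move: T; apply: obtainable_ind => // E r r' c0 leE leg.
by rewrite (colcount_slide _ _ leg); apply: leq_trans leE; apply: leq_subr.
Qed.

Lemma colcount1_obtainable D T c : obtainable D T -> colcount T c 1 = colcount D c 1.
Proof.
move: T; apply: obtainable_ind => // E r r' c0 eqE leg.
rewrite (colcount_slide _ _ leg) -eqE; case: leg => /andP[r'0 _] _ _ _ _.
by rewrite ltnNge r'0 andbF subn0.
Qed.

(** A row holds at most one cell of a column and column totals are preserved, so the rows below [s],
    full in [D], cannot take in further cells. *)
Lemma colcount_full D T c s : obtainable D T -> 0 < s ->
  (forall q, 0 < q < s -> (q, c) \in D) -> colcount T c s = colcount D c s.
Proof.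
move=> DT; case: s => // s _ full; apply/eqP; rewrite eqn_leq.
rewrite colcount_obtainable //=; elim: s full => [|s IH] full.
  by rewrite (colcount1_obtainable _ DT).
have /IH : forall q, 0 < q < s.+1 -> (q, c) \in D by move=> q ?; apply: full; lia.
rewrite (colcountS D) (colcountS T) full ?leqnn //=.
by case: (_ \in T) => /=; lia.
Qed.

(** * Key shapes and comparison of columns *)

Definition key_shape D f : Prop :=
  forall i j, ((i, j) \in D) = (0 < i) && (0 < j <= f i).

Definition obstruction f i j k : bool :=
  [&& 0 < i < j, j < k, f i < f j, f i < f k & (f i).+1 < maxn (f j) (f k)].

Lemma row_bound D : exists m, forall x, x \in D -> x.1 < m /\ x.2 < m.
Proof.
exists (\max_(x <- D) maxn x.1 x.2).+1 => x xD.
have := leq_bigmax_seq (F := fun x : cell => maxn x.1 x.2) x xD isT.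
by rewrite /= geq_max !ltnS => /andP.
Qed.

Lemma colcount_subset D c d s :
  (forall r, (r, d) \in D -> (r, c) \in D) -> colcount D d s <= colcount D c s.
Proof.
move=> sub; have [m mP] := row_bound D.
have col0 e s' : m <= s' -> colcount D e s' = 0.
  move=> le; apply/eqP; rewrite -leqn0 leqNgt; apply/colcount_gt0 => -[q leq /mP[/=]].
  by lia.
have [k] := ubnP (m - s); elim: k s => // k IH s ltk.
have [le|lt] := leqP m s; first by rewrite !col0.
rewrite (colcountS D d) (colcountS D c); apply: leq_add; last by apply: IH; lia.
by have := sub s; case: (_ \in _) => // ->.
Qed.

(** By induction on the moves. Only a slide in column [c] could break the inequality; its source row
    has no cell in column [d], and column [c] is full between source and target, so the inequality
    was strict there. *)
Lemma colcount_decr D T c d s : c < d ->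
  (forall r, (r, d) \in D -> (r, c) \in D) -> obtainable D T ->
  colcount T d s <= colcount T c s.
Proof.
move=> ltcd sub DT; move: T DT s.
apply: obtainable_ind => [s|E r r' e IH leg s]; first exact: colcount_subset.
rewrite !(colcount_slide _ _ leg).
have [ce|_] := eqVneq c e; last by rewrite subn0; apply: leq_trans (leq_subr _ _) _.
rewrite -ce gtn_eqF // subn0 in leg *.
have [/andP[lt le]|_] := boolP (r' < s <= r); last by rewrite subn0.
case: leg => _ rcE _ cmax full.
suff : colcount E d s < colcount E c s by lia.
have [k] := ubnP (r - s); elim: k s lt le => // k IHk s lt le ltk.
rewrite (colcountS E d) (colcountS E c).
have [esr|nesr] := eqVneq s r.
  rewrite esr rcE add1n ltnS; have [rdE|_] := boolP (_ \in E); last exact: IH.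
  by have := cmax _ rdE; rewrite leqNgt ltcd.
rewrite full ?lt ?ltn_neqAle ?nesr //.
have := IHk s.+1; case: (_ \in _) => /=; lia.
Qed.

Lemma row_sizeE T r : row_size T r = \sum_(x <- T) (x.1 == r).
Proof.
rewrite /row_size card_fset_sum1 -big_fset_condE big_mkcond.
by apply: eq_bigr => x _; case: eqP.
Qed.

Lemma sum_colcount T m s : (forall x, x \in T -> x.1 < m /\ x.2 < m) ->
  \sum_(c < m) colcount T c s = \sum_(s <= r < m) row_size T r.
Proof.
move=> mP; rewrite (eq_bigr _ (fun r _ => row_sizeE T r)) exchange_big /=.
rewrite [RHS]exchange_big /= big_seq [RHS]big_seq; apply: eq_bigr => x /mP[lt1 lt2].
rewrite (bigD1 (Ordinal lt2)) //= eqxx big1 ?addn0 => [|i]; last first.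
  by rewrite -val_eqE /= eq_sym => /negbTE->.
have [le|gt] := leqP s x.1.
  rewrite (bigD1_seq x.1) ?iota_uniq ?mem_index_iota ?le //= eqxx big1 ?addn0 // => i.
  by rewrite eq_sym => /negbTE->.
rewrite big_nat big1 // => i /andP[lei _].
by rewrite ltn_eqF // (leq_trans gt).
Qed.

Lemma sum_eq_lt m (F G : nat -> nat) c : \sum_(i < m) F i = \sum_(i < m) G i ->
  c < m -> F c < G c -> exists d, G d < F d.
Proof.
move=> eqFG ltc ltFG; have [/existsP[d ltd]|/existsPn no] :=
  boolP [exists d : 'I_m, G d < F d]; first by exists d.
suff : \sum_(i < m) F i < \sum_(i < m) G i by rewrite eqFG ltnn.
rewrite (bigD1 (Ordinal ltc)) // [ltnRHS](bigD1 (Ordinal ltc)) //= -addSn.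
by apply: leq_add => //; apply: leq_sum => i _; rewrite leqNgt no.
Qed.

(** * Unobstructed shapes *)

Section UnobstructedShape.
Variables (D : diagram) (f : nat -> nat).
Hypotheses (Df : key_shape D f) (free : forall i j k, ~~ obstruction f i j k).

Lemma no_crossing T T' c d s : obtainable D T -> obtainable D T' -> 0 < s ->
  c < d -> colcount T c s < colcount T' c s -> colcount T' d s < colcount T d s ->
  False.
Proof.
move=> DT DT' s0 ltcd ltc ltd.
have leDc := leq_trans ltc (colcount_obtainable c s DT').
have [q lesq qdD] : exists2 q, s <= q & (q, d) \in D.
  apply/colcount_gt0; apply: leq_trans (colcount_obtainable d s DT); lia.
have c0 : 0 < c.
  have /colcount_gt0[p _] : 0 < colcount D c s by lia.
  by rewrite Df; case/and3P.
have sub r : (r, d) \in D -> (r, c) \in D by rewrite !Df; lia.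
have le_dc := colcount_decr s ltcd sub DT.
(* At [s], 1 <= N_d(T) <= N_c(T) < N_c(T') <= N_c(D). *)
have [q' lesq' /andP[neq q'D]] : exists2 q', s <= q' & (q' != q) && ((q', c) \in D).
  by apply: colcount_gt1 (sub _ qdD) _; lia.
(* If column [c] of [D] were full below [s], its count would be kept: N_c(T) = N_c(D). *)
have [i lti niD] : exists2 i, 0 < i < s & (i, c) \notin D.
  have [/hasP[i]|/hasPn full] := boolP (has (fun i => (i, c) \notin D) (index_iota 1 s)).
    by rewrite mem_index_iota; exists i.
  move: leDc; rewrite (colcount_full DT) ?ltnn // => p ltp.
  by apply/negPn/full; rewrite mem_index_iota.
(* Row [q] reaches column [d], so [(f i).+2 <= f q]; the order of [q] and [q'] is unknown, whence
   two instances. *)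
have := free i q q'; have := free i q' q; move: qdD q'D niD neq.
rewrite !Df /obstruction => *; lia.
Qed.

Lemma unobstructed_inj T T' : obtainable D T -> obtainable D T' ->
  (forall r, row_size T r = row_size T' r) -> T = T'.
Proof.
move=> DT DT' eq_row.
have [N NP] := row_bound D.
have rowsD x : x \in D -> 0 < x.1 <= N.
  by case: x => q e xD; have := NP _ xD; move: xD; rewrite Df /=; lia.
have pos U : obtainable D U -> forall c, ((0, c) \in U) = false.
  by move=> DU c; apply/negP => /(obtainable_rows rowsD DU).
have [m mP] := row_bound T; have [m' mP'] := row_bound T'.
have bound x : x \in T \/ x \in T' -> x.1 < maxn m m' /\ x.2 < maxn m m'.
  by case=> [/mP|/mP'] [? ?]; rewrite !leq_max; lia.
have sums s : \sum_(c < maxn m m') colcount T c s = \sum_(c < maxn m m') colcount T' c s.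
  by rewrite !sum_colcount; [apply: eq_bigr | auto..].
have cmp U U' c s : obtainable D U -> obtainable D U' -> 0 < s ->
    (forall x, x \in U' -> x.2 < maxn m m') ->
    \sum_(c < maxn m m') colcount U c s = \sum_(c < maxn m m') colcount U' c s ->
    colcount U c s < colcount U' c s -> False.
  move=> DU DU' s0 bU' eqs lt.
  have ltc : c < maxn m m'.
    have /colcount_gt0[q _ /bU'] : 0 < colcount U' c s by lia.
    by [].
  (* Equal sums turn a deficit in column [c] into an excess in some column [d]; either order of the
     two is a crossing. *)
  have [d ltd] := sum_eq_lt (F := colcount U ^~ s) (G := colcount U' ^~ s) eqs ltc lt.
  have [ltcd|ltdc|ecd] := ltngtP c d; last by move: lt ltd; rewrite ecd; lia.
    exact: no_crossing DU DU' s0 ltcd lt ltd.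
  exact: no_crossing DU' DU s0 ltdc ltd lt.
have eqS c s : colcount T c s.+1 = colcount T' c s.+1.
  have [lt|gt|//] := ltngtP (colcount T c s.+1) (colcount T' c s.+1).
    by case: (cmp T T' c s.+1) => // x xT'; case: (bound x); auto.
  by case: (cmp T' T c s.+1) => // x xT; case: (bound x); auto.
(* Row 0 is empty in both diagrams, so positive thresholds suffice. *)
apply: colcount_inj => c [|s] //.
by rewrite (colcountS T) (colcountS T') !pos // eqS.
Qed.
End UnobstructedShape.

(** * Obstructed shapes *)

Inductive unit_reach : diagram -> diagram -> Prop :=
| unit_refl D : unit_reach D D
| unit_step D E r : height D = (height (kohnert_move D r)).+1 ->
    unit_reach (kohnert_move D r) E -> unit_reach D E.

Lemma unit_reach_trans D E T : unit_reach D E -> unit_reach E T -> unit_reach D T.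
Proof. by elim=> // {}D {}E r hD _ IH /IH; apply: unit_step. Qed.

Lemma unit_reach_obtainable D E : unit_reach D E -> obtainable D E.
Proof.
elim=> [{}D|{}D {}E r _ _ IH]; first exact: obtainable_refl.
exact: obtainable_trans (obtainable_move D r) IH.
Qed.

(** The diagrams visited on the way form the chain; steps of one skip no height. *)
Lemma unit_reach_chain D E : unit_reach D E -> exists s : seq diagram,
  [/\ forall Z, Z \in s -> obtainable D Z,
      forall Z W, Z \in s -> W \in s -> obtainable Z W \/ obtainable W Z
    & forall h, height E <= h <= height D -> exists2 Z, Z \in s & height Z = h].
Proof.
elim=> [{}D|{}D {}E r hD _ [s [sub cmp onto]]].
  exists [:: D]; split=> [Z|Z W|h].
  - by rewrite inE => /eqP->; apply: obtainable_refl.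
  - by rewrite !inE => /eqP-> /eqP->; left; apply: obtainable_refl.
  - by move=> hh; exists D; rewrite ?inE //; lia.
have subD Z : Z \in s -> obtainable D Z.
  by move/sub; apply: obtainable_trans; apply: obtainable_move.
exists (D :: s); split=> [Z|Z W|h hh].
- by rewrite inE => /predU1P[->|/subD //]; apply: obtainable_refl.
- rewrite !inE => /predU1P[->|Zs] /predU1P[->|Ws]; last exact: cmp.
  + by left; apply: obtainable_refl.
  + by left; apply: subD.
  + by right; apply: subD.
- have [->|neq] := eqVneq h (height D); first by exists D; rewrite // mem_head.
  have [|Z Zs hZ] := onto h; first by lia.
  by exists Z; rewrite // inE Zs orbT.
Qed.

(** The cells of row [k] fall from right to left, the one in column [c] to row [g c]. A move alters
    only its own column, so the assumptions on the columns still to come persist. *)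
Lemma row_sweep D k e b (g : nat -> nat) : e <= b ->
  (forall c, ((k, c) \in D) = (0 < c <= b)) ->
  (forall c, e < c <= b -> [/\ 0 < g c < k, (g c, c) \notin D
     & forall q, g c < q < k -> (q, c) \in D]) ->
  exists T, [/\ obtainable D T, (forall c, e < c <= b -> (g c).+1 = k) -> unit_reach D T
    & forall q c, ((q, c) \in T) =
       if q == k then 0 < c <= e else ((q, c) \in D) || (e < c <= b) && (q == g c)].
Proof.
have [m] := ubnP (b - e); elim: m e => // m IH e ltm le row gap.
have [eb|ltb] := eqVneq e b.
  exists D; split=> [|_|q c]; [exact: obtainable_refl|exact: unit_refl|].
  by case: eqP => [->|_]; rewrite ?row eb //; case: (_ \in D) => //; lia.
have [||//|c hc|T [DT uT memT]] := IH e.+1; try lia; first by apply: gap; lia.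
have {}ltb : e < b by lia.
have [hg ngD full] := gap e.+1 (ltac:(lia)).
have leg : legal_move T k (g e.+1) e.+1.
  split=> //.
  - by rewrite memT eqxx; lia.
  - by rewrite memT ltn_eqF ?(negbTE ngD) /=; lia.
  - by move=> c'; rewrite memT eqxx; lia.
  - by move=> q hq; rewrite memT full // orTb; case: eqP => //; lia.
exists (kohnert_move T k); split.
- exact: obtainable_trans DT (obtainable_move T k).
- move=> gk; apply: unit_reach_trans (uT _) _; first by move=> c hc; apply: gk; lia.
  apply: (unit_step (r := k)); last exact: unit_refl.
  rewrite (kohnert_move_legal leg); have := height_slide leg.
  by have := gk e.+1; lia.
- move=> q c; rewrite (kohnert_move_legal leg) in_slide memT !xpair_eqE.
  have [->|nqk] := eqVneq q k; first by have := hg; lia.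
  have [->|nce] := eqVneq c e.+1; last by case: (_ \in D); lia.
  by case: (_ \in D) => /=; lia.
Qed.

Definition swap_rows f i : nat -> nat :=
  fun q => if q == i then f i.+1 else if q == i.+1 then f i else f q.

Lemma unit_swap D f i : key_shape D f -> 0 < i -> f i < f i.+1 ->
  exists2 E, unit_reach D E & key_shape E (swap_rows f i).
Proof.
move=> Df i0 lt.
have [|c|c hc|T [_ uT memT]] := @row_sweep D i.+1 (f i) (f i.+1) (fun=> i).
- exact: ltnW.
- by rewrite Df.
- by rewrite Df; split=> [||q]; lia.
exists T; first by apply: uT.
move=> q c; rewrite memT Df /swap_rows.
have [->|nq] := eqVneq q i.+1; first by rewrite gtn_eqF //; lia.
by have [->|nqi] := eqVneq q i; lia.
Qed.

(** Bubble sort, which stops because every swap lowers the height. *)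
Lemma unit_reach_sorted D f : key_shape D f -> exists E g,
  [/\ unit_reach D E, key_shape E g & forall i, 0 < i -> g i.+1 <= g i].
Proof.
have [m] := ubnP (height D); elim: m D f => // m IH D f ltm Df.
have [M MP] := row_bound D.
have [/hasP[i]|/hasPn sorted] := boolP (has (fun i => f i < f i.+1) (index_iota 1 M)).
  rewrite mem_index_iota => /andP[i0 _] lt.
  have [E DE Ef] := unit_swap Df i0 lt.
  have [|T [g [ET Tg gs]]] := IH E (swap_rows f i) _ Ef; last first.
    by exists T, g; split=> //; apply: unit_reach_trans DE ET.
  (* A swap is never idle: row [i] of [E] reaches column [f i.+1], row [i] of [D] does not. *)
  have [eED|] := obtainable_height (unit_reach_obtainable DE); last by lia.
  have := Ef i (f i.+1); rewrite eED Df /swap_rows eqxx; lia.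
exists D, f; split=> // [|i i0]; first exact: unit_refl.
have [ltM|leM] := ltnP i M.
  by have := sorted i; rewrite mem_index_iota i0 ltM -leqNgt => ->.
have := Df i.+1 (f i.+1); rewrite leqnn andbT /=.
by case: (f i.+1) => // k /MP[/=]; lia.
Qed.

(** With rows shrinking upwards no cell has a hole below it, so no move is legal. *)
Lemma sorted_minimal D f T : key_shape D f -> (forall i, 0 < i -> f i.+1 <= f i) ->
  obtainable D T -> T = D.
Proof.
move=> Df fs; move: T; apply: obtainable_ind => // E r r' c -> [lt rcD r'D _ _].
have mono i j : 0 < i <= j -> f j <= f i.
  move=> /andP[i0 /subnK <-]; elim: (j - i) => //= k; apply: leq_trans.
  by rewrite addSn fs // addn_gt0 i0 orbT.
by have := mono r' r; move: rcD r'D; rewrite !Df; lia.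
Qed.

(* Sliding the cell [(i.+2, c)] to [(i, c)] lowers the height by two, yet is a
   cover: the only shortcut, sliding [(i.+1, c)] first, is blocked by
   [(i.+1, c')]. *)
Definition long_cover T i c : Prop :=
  legal_move T i.+2 i c /\ exists2 c', c < c' & (i.+1, c') \in T.

Lemma long_coverP T i c Z : long_cover T i c -> obtainable T Z ->
  obtainable Z (slide T i.+2 i c) -> (height Z).+1 <> height T.
Proof.
case=> leg [c' ltc c'T] TZ ZT' hZ.
have [|r [r' [d [legd dZ]]]] := obtainable_first TZ; first by move=> e; move: hZ; rewrite e; lia.
(* Column counts never increase, so the first move, which lowers the count of column [d] at [r],
   must stay within the loss of the long slide: [d = c], and [r] is [i.+1] or [i.+2]. *)
have := colcount_obtainable d r (obtainable_trans dZ ZT').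
rewrite (colcount_slide _ _ leg) (colcount_slide _ _ legd) eqxx /=.
have [/andP[r'0 ltr] rdT _ rmax _] := legd.
have : 0 < colcount T d r by apply/colcount_gt0; exists r.
have [edc|ndc] := eqVneq d c; last by rewrite ltr leqnn; lia.
rewrite {d}edc ltr leqnn /= in legd dZ rdT rmax * => N0 leN.
have [er|er] : r = i.+1 \/ r = i.+2 by lia.
  by have := rmax c'; rewrite er c'T => /(_ isT); rewrite leqNgt ltc.
(* A move at row [i.+2] is the long slide itself, which already lowers the height by two. *)
have := obtainable_height dZ.
rewrite -(kohnert_move_legal legd) er (kohnert_move_legal leg).
have hs := height_slide leg.
by case=> [eZ|]; [rewrite eZ in hZ|]; lia.
Qed.

(** The triple is pulled together, by swaps or by choosing other rows, until its rows are adjacent;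
    the measure adds the distances of [j] and [k] from [i]. *)
Lemma obstruction_long_cover D f i j k : key_shape D f -> obstruction f i j k ->
  exists T i' c, obtainable D T /\ long_cover T i' c.
Proof.
have [m] := ubnP (k - i + (j - i)); elim: m D f i j k => // m IH D f i j k ltm Df.
rewrite /obstruction => obs.
(* For adjacent rows, [(i.+1, (f i).+2)] is a cell after the sweep: it was there
   already if [(f i).+2 <= f i.+1], and otherwise it fell from row [i.+2]. *)
have [kE|nk] := eqVneq k i.+2.
  have jE : j = i.+1 by lia.
  rewrite {}kE {}jE in obs.
  (* A cell of row [i.+2] falls to row [i] where row [i.+1] is filled, and stops in row [i.+1]
     beyond its end. *)
  pose g c := if c <= f i.+1 then i else i.+1.
  have [|c|c hc|T [DT _ memT]] := @row_sweep D i.+2 (f i).+1 (f i.+2) g.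
  - by lia.
  - by rewrite Df.
  - rewrite /g; case: (leqP c (f i.+1)) => hcf; split; [lia|rewrite Df; lia|
      by move=> q hq; have -> : q = i.+1 by [lia]; rewrite Df; lia|lia|
      rewrite Df; lia|by move=> q hq; lia].
  exists T, i, (f i).+1; split=> //; split.
    split.
    + by lia.
    + by rewrite memT eqxx; lia.
    + by rewrite memT ltn_eqF ?Df; lia.
    + by move=> c'; rewrite memT eqxx; lia.
    + move=> q hq; have -> : q = i.+1 by lia.
      by rewrite memT ltn_eqF ?Df; lia.
  exists (f i).+2 => //; rewrite memT ltn_eqF // Df /g.
  by case: (leqP (f i).+2 (f i.+1)) => ?; lia.
have [jE|nj] := eqVneq j i.+1.
  (* Either a swap brings the longer row [k] down to [k.-1], or row [k.-1] is long enough to replace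
     it. *)
  have [lt|ge] := ltnP (f k.-1) (f k).
    have k0 : 0 < k.-1 by lia.
    have kE : k.-1.+1 = k by lia.
    have [|E DE Ef] := unit_swap Df k0; first by rewrite kE.
    have [||T [i' [c [ET lc]]]] := IH E (swap_rows f k.-1) i j k.-1 _ Ef; first lia.
      by rewrite /obstruction /swap_rows kE eqxx !ltn_eqF; lia.
    exists T, i', c; split=> //.
    exact: obtainable_trans (unit_reach_obtainable DE) ET.
  by apply: (IH D f i j k.-1) => //; rewrite ?/obstruction; lia.
(* Row [i.+1] is short enough to replace [i], or it becomes the middle row under [k], or under [j]
   when [k] is too short: then [(f i).+1 < f j]. *)
have [le|gt] := leqP (f i.+1) (f i).
  by apply: (IH D f i.+1 j k) => //; rewrite ?/obstruction; lia.
have [lt|ge] := ltnP (f i).+1 (maxn (f i.+1) (f k)).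
  by apply: (IH D f i i.+1 k) => //; rewrite ?/obstruction; lia.
by apply: (IH D f i i.+1 j) => //; rewrite ?/obstruction; lia.
Qed.

(** * Purity *)

Section Purity.
Variable D : diagram.
Implicit Types (x y z : kohnert_poset D) (C : {set kohnert_poset D}).

Definition heights C : seq nat := [seq height (fsval x) | x <- enum C].

Lemma size_heights C : size (heights C) = #|C|.
Proof. by rewrite size_map -cardE. Qed.

Lemma leP_obtainable x y : reflect (obtainable (fsval y) (fsval x)) (x <= y)%O.
Proof. exact: KDP. Qed.

Lemma le_height x y : (x <= y)%O -> x = y \/ height (fsval x) < height (fsval y).
Proof.
by move/leP_obtainable/obtainable_height => [/val_inj|]; [left|right].
Qed.

Lemma heights_uniq C : is_chain C -> uniq (heights C).
Proof.
move=> /forall_inP chC; rewrite map_inj_in_uniq ?enum_uniq // => x y.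
rewrite !mem_enum => xC yC eqh; have /forall_inP/(_ y yC)/orP[] := chC x xC.
  by case/le_height=> //; rewrite eqh ltnn.
by case/le_height=> //; rewrite eqh ltnn.
Qed.

(** A maximal chain through the unit steps from [D] to [E] meets every height in the range. Heights
    on a chain are distinct, so one through [T] and [T'], which misses [s], has fewer elements. *)
Lemma height_gap_not_pure E s T T' :
  unit_reach D E -> (forall z, height E <= height (fsval z)) ->
  obtainable D T -> obtainable T T' -> height E <= s < height D ->
  height T' < s < height T ->
  (forall Z, obtainable T Z -> obtainable Z T' -> height Z <> s) ->
  ~ pure (kohnert_poset D).
Proof.
move=> DE minE DT TT' sD sT gap pureD.
have [l [subl cmpl ontol]] := unit_reach_chain DE.
pose C1 : {set kohnert_poset D} := [set x | fsval x \in l].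
have chC1 : is_chain C1.
  apply/forall_inP => x; rewrite inE => xl; apply/forall_inP => y; rewrite inE => yl.
  by apply/orP; case: (cmpl _ _ xl yl) => ?; [right|left]; apply/leP_obtainable.
have /KDP TK := DT; have /KDP T'K := obtainable_trans DT TT'.
pose t : kohnert_poset D := [` TK]; pose t' : kohnert_poset D := [` T'K].
have le_t : (t' <= t)%O by apply/leP_obtainable.
have chC2 : is_chain [set t; t'].
  apply/forall_inP => x /set2P[]->; apply/forall_inP => y /set2P[]->;
  by rewrite /Order.comparable ?lexx ?le_t ?orbT.
have [M1 maxM1 /subsetP sub1] := maxset_exists chC1.
have [M2 maxM2 /subsetP sub2] := maxset_exists chC2.
have [ch1 _] := maxsetP maxM1; have [ch2 _] := maxsetP maxM2.
have tM : t \in M2 by apply: sub2; rewrite set21.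
have t'M : t' \in M2 by apply: sub2; rewrite set22.
have onto1 : {subset iota (height E) (height D - height E).+1 <= heights M1}.
  move=> h; rewrite mem_iota => hh; have [|Z Zl <-] := ontol h; first by lia.
  have /KDP ZK := subl _ Zl; apply/mapP; exists ([` ZK] : kohnert_poset D) => //.
  by rewrite mem_enum sub1 // inE.
have into2 : {subset s :: heights M2 <= iota (height E) (height D - height E).+1}.
  move=> h; rewrite inE mem_iota => /predU1P[->|/mapP[z _ ->]]; first by lia.
  by have := minE z; have /KDP/obtainable_height[->|] := fsvalP z; lia.
have uniq2 : uniq (s :: heights M2).
  rewrite /= heights_uniq // andbT; apply/mapP => -[z]; rewrite mem_enum => zM hz.
  have /forall_inP chz := ch2; have /forall_inP cz := chz z zM.
  apply: (gap (fsval z)); last by [].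
    have /orP[/leP_obtainable//|/le_height[ez|]] := cz _ tM.
      by rewrite -ez in hz; move: sT; rewrite hz /= ltnn andbF.
    by move=> /= lt; lia.
  have /orP[/le_height[ez|]|/leP_obtainable//] := cz _ t'M.
    by rewrite ez in hz; move: sT; rewrite hz /= ltnn.
  by move=> /= lt; lia.
have := uniq_leq_size uniq2 into2.
have := uniq_leq_size (iota_uniq _ _) onto1.
rewrite size_iota [size (_ :: _)]/= !size_heights (pureD _ _ maxM1 maxM2).
by move=> le1 le2; have := leq_trans le2 le1; rewrite ltnn.
Qed.

Lemma pure_unobstructed f : key_shape D f -> pure (kohnert_poset D) ->
  bounded_poset (kohnert_poset D) -> forall i j k, ~~ obstruction f i j k.
Proof.
move=> Df pureD [[x0 min0] _] i j k; apply/negP => obs.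
have [T [i' [c [DT lc]]]] := obstruction_long_cover Df obs.
have [E [g [DE Eg gs]]] := unit_reach_sorted Df.
(* The sorted diagram [E] admits no move, so the minimum of the poset equals it. *)
have minE z : height E <= height (fsval z).
  have /KDP EK := unit_reach_obtainable DE.
  have /leP_obtainable := min0 ([` EK] : kohnert_poset D).
  move=> /(sorted_minimal Eg gs) <-.
  by case: (le_height (min0 z)) => [->|/ltnW].
have leg := lc.1; have hs := height_slide leg.
have TT' : obtainable T (slide T i'.+2 i' c).
  by rewrite -(kohnert_move_legal leg); apply: obtainable_move.
have /KDP T'K := obtainable_trans DT TT'.
have /= hE := minE ([` T'K] : kohnert_poset D).
have hD : height T <= height D by case: (obtainable_height DT) => [->|/ltnW].
(* The long slide lowers the height by two, so [(height T).-1] lies strictly between. *)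
apply: (height_gap_not_pure (s := (height T).-1) DE minE DT TT' _ _ _ pureD); try lia.
by move=> Z TZ ZT' hZ; apply: (long_coverP lc TZ ZT'); lia.
Qed.

End Purity.

(** * From row sizes to coefficients *)

Lemma key_diagram_shape n (a : n.-tuple nat) :
  key_shape (key_diagram a) (fun i => nth 0 a i.-1).
Proof.
move=> i j; rewrite !inE; apply/allpairsPdep/idP => [[p [q []]]|].
  by rewrite !mem_iota => hp hq [-> ->]; lia.
move=> hij; exists i, j; rewrite !mem_iota; split=> //; last by lia.
(* Above row [n] the default 0 of [nth] gives an empty row. *)
have [|le] := ltnP i.-1 n; first by lia.
by move: hij; rewrite nth_default ?size_tuple //; lia.
Qed.

Local Open Scope ring_scope.

Definition wt_mnm n T : 'X_{1..n} := [multinom row_size T i.+1 | i < n].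

Lemma wtE n T : wt n T = 'X_[wt_mnm n T].
Proof.
by rewrite mpolyXE_id; apply: eq_bigr => i _; rewrite mnmE.
Qed.

(** A coefficient counts the diagrams with a given exponent vector, here at most one. *)
Lemma wt_inj_multiplicity_free n D :
  {in KD D &, injective (wt_mnm n)} -> multiplicity_free (kohnert_poly n D).
Proof.
move=> inj m; rewrite /kohnert_poly raddf_sum /=.
rewrite (eq_bigr (fun T => (wt_mnm n T == m)%:R)) => [|T _]; last first.
  by rewrite wtE mcoeffX.
have [/hasP[T TK /eqP eT]|/hasPn no] := boolP (has (fun T => wt_mnm n T == m) (KD D)).
  right; rewrite (big_fsetD1 T) //= eT eqxx big_seq big1 ?addr0 // => U.
  rewrite in_fsetD1 => /andP[neq UK]; case: eqP => // eU.
  by rewrite (inj U T UK TK) ?eqxx ?eU ?eT in neq.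
by left; rewrite big_seq big1 // => T /no /negbTE->.
Qed.

Theorem theorem5p16 (n : nat) (a : n.-tuple nat) :
  pure (kohnert_poset (key_diagram a)) ->
  EL_shellable (kohnert_poset (key_diagram a)) ->
  multiplicity_free (kohnert_poly n (key_diagram a)).
Proof.
move=> pureD [bD _]; apply: wt_inj_multiplicity_free => T T' /KDP DT /KDP DT' eqw.
have Df := key_diagram_shape a.
apply: (unobstructed_inj Df (pure_unobstructed Df pureD bD) DT DT') => r.
have rowsD x : x \in key_diagram a -> (0 < x.1 <= n)%N.
  case: x => q e; rewrite Df /=; have [|le] := ltnP q.-1 n; first by lia.
  by rewrite nth_default ?size_tuple //; lia.
(* The exponent vector records rows 1 to [n]; all other rows are empty in both diagrams. *)
have [rn|rn] := boolP (0 < r <= n)%N.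
  have rn1 : (r.-1 < n)%N by lia.
  have := congr1 (fun m : 'X_{1..n} => m (Ordinal rn1)) eqw.
  by rewrite !mnmE /= prednK //; case/andP: rn.
rewrite !row_sizeE big_seq big1 ?[RHS]big_seq ?big1 // => x.
- by move/(obtainable_rows rowsD DT'); case: eqP => // ->; rewrite (negbTE rn).
- by move/(obtainable_rows rowsD DT); case: eqP => // ->; rewrite (negbTE rn).
Qed.
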